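(* Let $X_0 \in \mathbb{R}^{n\times p}$ and $\lambda>0$ be such that for every $y\in\mathbb{R}^n$ the lasso problem $\min_{\beta_0\in\mathbb{R}^p}\frac12\|y-X_0\beta_0\|_2^2+\lambda\|\beta_0\|_1$ has a unique minimizer. Then the total number of accessible lasso models of size $k$ is no more than $f_{k-1}(n,2p)$.
   Context: Let $X=(X_0,-X_0)\in\mathbb{R}^{n\times 2p}$. The lasso problem is equivalently written as: minimize $\frac12\|y-X\beta\|_2^2+\lambda\sum_{j=1}^{2p}\beta_j$ over $\beta\in\mathbb{R}^{2p}$ with $\beta\ge 0$ (coordinatewise), where $\beta=(\beta_0^+,\beta_0^-)$ consists of the positive and negative parts of $\beta_0$. Uniqueness of the lasso minimizer for every $y$ gives a unique solution $\beta(y)$ of this problem for every $y$. Define $\mathrm{supp}(\beta)=\{1\le j\le 2p:\beta_j>0\}$. A signed model is a subset $S\subset\{1,\dots,2p\}$, and $A_S=\{y\in\mathbb{R}^n:\mathrm{supp}(\beta(y))=S\}$. A signed model $S$ is called accessible if $A_S\neq\emptyset$. The size of $S$ is $|S|$, the number of nonzero coefficients. A cyclic polytope with $v$ vertices in $d$ dimensions is the convex hull of $v$ points $(t_i,t_i^2,\dots,t_i^d)$, $1\le i\le v$, with the real numbers $t_i$ pairwise distinct. $f_k(d,v)$ denotes the number of $k$-dimensional faces of a cyclic polytope with $v$ vertices in $d$ dimensions (this does not depend on the choice of the $t_i$). The empty face has dimension $-1$, so $f_{-1}(d,v)=1$. *)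

(* Defs.v *)
From HB Require Import structures.
From mathcomp Require Import all_boot all_order all_algebra.
From mathcomp Require Import finmap.
From mathcomp Require Import boolp classical_sets functions cardinality reals.

Set Implicit Arguments.
Unset Strict Implicit.
Unset Printing Implicit Defensive.

Import Order.TTheory GRing.Theory Num.Theory.

Local Open Scope classical_set_scope.
Local Open Scope ring_scope.

Definition is_argmin (R : realType) (T : Type) (D : set T) (f : T -> R) (b : T) :=
  D b /\ forall b', D b' -> f b <= f b'.

Section Lasso.
Variables (R : realType) (n p : nat).
Implicit Types (lambda : R) (y : 'cV[R]_n).

Definition sqnorm2 (m : nat) (v : 'cV[R]_m) : R := \sum_i v i 0 ^+ 2.

Definition norm1 (m : nat) (v : 'cV[R]_m) : R := \sum_j `|v j 0|.

Definition lasso_objective (X0 : 'M[R]_(n, p)) lambda y (b0 : 'cV[R]_p) : R :=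
  2^-1 * sqnorm2 (y - X0 *m b0) + lambda * norm1 b0.

Definition lasso_unique (X0 : 'M[R]_(n, p)) lambda : Prop :=
  forall y, exists! b0, is_argmin setT (lasso_objective X0 lambda y) b0.

Definition signed_design (X0 : 'M[R]_(n, p)) : 'M[R]_(n, p + p) := row_mx X0 (- X0).

Definition signed_objective (X0 : 'M[R]_(n, p)) lambda y (b : 'cV[R]_(p + p)) : R :=
  2^-1 * sqnorm2 (y - signed_design X0 *m b) + lambda * \sum_j b j 0.

Definition nonneg_cone (m : nat) : set 'cV[R]_m := [set b | forall j, 0 <= b j 0].

Definition is_signed_solution (X0 : 'M[R]_(n, p)) lambda y (b : 'cV[R]_(p + p)) : Prop :=
  is_argmin (@nonneg_cone (p + p)) (signed_objective X0 lambda y) b.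

Definition supp (m : nat) (b : 'cV[R]_m) : {set 'I_m} := finset (fun j => 0 < b j 0).

(* The set A_S: when the lasso minimizer is unique for every response and
   0 < lambda, the signed solution exists and is unique, so the existential
   ranges over the single vector beta(y). *)
Definition model_region (X0 : 'M[R]_(n, p)) lambda (S : {set 'I_(p + p)}) : set 'cV[R]_n :=
  [set y | exists2 b, is_signed_solution X0 lambda y b & supp b = S].

Definition accessible (X0 : 'M[R]_(n, p)) lambda (S : {set 'I_(p + p)}) : Prop :=
  model_region X0 lambda S !=set0.

Definition num_accessible (X0 : 'M[R]_(n, p)) lambda (k : nat) : nat :=
  #|[pred S : {set 'I_(p + p)} | `[< accessible X0 lambda S >] & #|S| == k]|.

End Lasso.

Section Polytopes.
Variables (R : realType) (d : nat).
Implicit Types (P F : set 'cV[R]_d).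

Definition conv_hull (v : nat) (x : 'I_v -> 'cV[R]_d) : set 'cV[R]_d :=
  [set z | exists a : 'I_v -> R,
    [/\ forall i, 0 <= a i, \sum_i a i = 1 & z = \sum_i a i *: x i]].

Definition aff_hull F : set 'cV[R]_d :=
  [set z | exists (m : nat) (x : 'I_m -> 'cV[R]_d) (a : 'I_m -> R),
    [/\ forall i, F (x i), \sum_i a i = 1 & z = \sum_i a i *: x i]].

Definition has_dim F (k : int) : Prop :=
  (F = set0 /\ k = -1) \/
  exists (x : 'cV[R]_d) (U : {vspace 'cV[R]_d}),
    aff_hull F = [set x + u | u in [set u | u \in U]] /\ k = (\dim U)%:Z.

(* [c = 0] gives the improper faces: P itself and the empty face. *)
Definition is_face P F : Prop :=
  exists (c : 'rV[R]_d) (c0 : R),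
    (forall x, P x -> (c *m x) 0 0 <= c0) /\
    F = P `&` [set x | (c *m x) 0 0 = c0].

Definition faces P (k : int) : set (set 'cV[R]_d) :=
  [set F | is_face P F /\ has_dim F k].

(* [fset_set] is meaningful only on finite sets; see [finite_faces]. *)
Definition num_faces P (k : int) : nat := #|` fset_set (faces P k)|%fset.

Definition moment_point (s : R) : 'cV[R]_d := \col_(j < d) s ^+ j.+1.

Definition cyclic_polytope (v : nat) (t : 'I_v -> R) : set 'cV[R]_d :=
  conv_hull (fun i => moment_point (t i)).

Lemma face_conv_hull (v : nat) (x : 'I_v -> 'cV[R]_d) F :
  is_face (conv_hull x) F ->
  F = [set z | exists a : 'I_v -> R,
    [/\ forall i, 0 <= a i, \sum_i a i = 1, z = \sum_i a i *: x i &
        forall i, a i != 0 -> F (x i)]].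
Proof.
case=> c [c0 [le_c ->]].
have Px i : conv_hull x (x i).
  exists (fun j => (j == i)%:R); split => [j||]; first exact: ler0n.
    by rewrite (bigD1 i) //= eqxx big1 ?addr0 // => j /negPf ->.
  rewrite (bigD1 i) //= eqxx scale1r big1 ?addr0 // => j /negPf ->.
  by rewrite scale0r.
have cE (a : 'I_v -> R) :
    (c *m (\sum_i a i *: x i)) 0 0 = \sum_i a i * (c *m x i) 0 0.
  by rewrite mulmx_sumr summxE; apply: eq_bigr => i _; rewrite -scalemxAr mxE.
apply/seteqP; split=> z /=.
  move=> [[a [a0 a1 ->]]]; rewrite cE => ac.
  exists a; split=> // i ai; split; first exact: Px.
  have: \sum_i a i * (c0 - (c *m x i) 0 0) = 0.
    under eq_bigr do rewrite mulrBr.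
    by rewrite sumrB -mulr_suml a1 mul1r ac subrr.
  move/eqP; rewrite psumr_eq0 => [/allP /(_ i)|j _]; last first.
    by rewrite mulr_ge0 // subr_ge0; apply: le_c.
  rewrite mem_index_enum => /(_ isT) /=.
  by rewrite mulf_eq0 (negPf ai) /= subr_eq0 => /eqP.
move=> [a [a0 a1 -> Fa]]; split; first by exists a.
rewrite cE -[RHS]mul1r -a1 mulr_suml; apply: eq_bigr => i _.
by have [->|/Fa [_ ->]] := eqVneq (a i) 0; rewrite ?mul0r.
Qed.

Lemma finite_faces (v : nat) (x : 'I_v -> 'cV[R]_d) (k : int) :
  finite_set (faces (conv_hull x) k).
Proof.
pose h (A : {set 'I_v}) : set 'cV[R]_d := [set z | exists a : 'I_v -> R,
    [/\ forall i, 0 <= a i, \sum_i a i = 1, z = \sum_i a i *: x i &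
        forall i, a i != 0 -> i \in A]].
apply: (@sub_finite_set _ _ (h @` setT)); last exact: finite_image.
move=> F [/face_conv_hull Fh _].
exists (finset (fun i => `[< F (x i) >])) => //; rewrite [RHS]Fh.
apply/seteqP; split=> z [a [a0 a1 az Fa]]; exists a; split=> // i /Fa.
  by rewrite inE => /asboolP.
by move=> Fi; rewrite inE; apply/asboolP.
Qed.

End Polytopes.

Arguments moment_point {R} d s.
Arguments cyclic_polytope {R} d {v} t.

(* Main.v *)
Require Import Defs.
From mathcomp Require Import all_boot all_order all_algebra.
From mathcomp Require Import zify ring lra.
From mathcomp Require Import boolp reals.

(* Dividing the residual by lambda, an accessible model S is a set of columns of
   (X0, -X0) lying on a common supporting hyperplane x.z = 1 of their convex
   hull P, and uniqueness of the lasso forces all such sets to be linearly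
   independent, so that P is a simplicial polytope with 2p (possibly redundant)
   vertices in dimension r = rank X0. It remains to prove McMullen's upper bound
   theorem.

   Points x_j with centroid 0 are given; work in the polar {u | x_j.u <= 1}. A
   generic functional c has on each facet F (a basis of the space) coordinates,
   and h_i counts the facets with i negative coordinates. Maximizing c over the
   faces of the polar gives f_(k-1) = sum_i h_i C(d-i, k-i), so h does not depend
   on c, and c -> -c gives h_i = h_(d-i). Replacing c by c + M x_w makes the
   facets through w optimal, whence #{F containing w | i negative coordinates
   other than w} <= h_i; summing over the v points w,
   (d-i) h_i + (i+1) h_(i+1) <= v h_i, so h_i <= C(v-d-1+i, i). For the cyclic
   polytope, squares of polynomials show that f_(k-1) = C(v, k) for 2k <= d,
   which turns these bounds into equalities; finally the resulting face numbers
   increase with the dimension, which handles r < n. *)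

Set Implicit Arguments.
Unset Strict Implicit.
Unset Printing Implicit Defensive.

Import Order.TTheory GRing.Theory Num.Theory.

(** * Binomial sums and h-vectors *)

Local Open Scope nat_scope.

Lemma sum_bin_diag a k : \sum_(i < k.+1) 'C(a + i, i) = 'C((a + k).+1, k).
Proof.
elim: k => [|k IH]; first by rewrite big_ord_recr big_ord0 /= !bin0.
by rewrite big_ord_recr /= IH addnS binS addnC.
Qed.

(** Pascal's rule and induction on [d]. In terms of h-vectors: h_i = C(a+i, i) for all i <= k means
    that every k-subset of a+d+1 vertices is a face. *)
Lemma sum_bin_conv a d k : k <= d ->
  \sum_(i < k.+1) 'C(a + i, i) * 'C(d - i, k - i) = 'C((a + d).+1, k).
Proof.
elim: d k => [|d IH] k kd.
  move: kd; rewrite leqn0 => /eqP ->.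
  by rewrite big_ord_recr big_ord0 /= !bin0.
move: kd; rewrite leq_eqVlt => /orP[/eqP ->|].
  rewrite -sum_bin_diag; apply: eq_bigr => i _ /=.
  by rewrite binn muln1.
rewrite ltnS; case: k => [|k] kd.
  by rewrite big_ord_recr big_ord0 /= !bin0.
rewrite addnS binS -IH // -IH; last exact: ltnW.
rewrite [in RHS]big_ord_recr [in LHS]big_ord_recr /= !subnn !bin0 !muln1.
rewrite addnAC; congr (_ + _); rewrite -big_split /=; apply: eq_bigr => i _.
have ik : i <= k by rewrite -ltnS.
rewrite -mulnDr (subSn ik) (subSn (leq_trans ik (ltnW kd))).
by rewrite binS.
Qed.

(** The system is unitriangular: the coefficient of [h k] in equation [k] is C(d-k, 0) = 1. *)
Lemma hvec_unique m d (h h' : nat -> nat) : m <= d ->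
  (forall k, k <= m -> \sum_(i < k.+1) h i * 'C(d - i, k - i) =
                       \sum_(i < k.+1) h' i * 'C(d - i, k - i)) ->
  forall i, i <= m -> h i = h' i.
Proof.
move=> md hh' i; elim/ltn_ind: i => i IH im.
have := hh' i im; rewrite !big_ord_recr /= subnn bin0 !muln1.
rewrite (eq_bigr (fun j : 'I_i => h' j * 'C(d - j, i - j))); first exact: addnI.
by move=> j _; rewrite IH // (leq_trans _ im) // ltnW.
Qed.

(* The h-vector of a neighborly simplicial d-polytope with a + d + 1 vertices. *)
Definition nbr_h a d i := 'C(a + minn i (d - i), minn i (d - i)).

Lemma leq_bin_diag a : {homo (fun m => 'C(a + m, m)) : m n / m <= n}.
Proof.
move=> m n mn /=.
rewrite -(bin_sub (leq_addl a m)) -(bin_sub (leq_addl a n)) !addnK.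
by rewrite leq_bin2l // leq_add2l.
Qed.

(** In the lower half this is Pascal's rule, with equality. In the upper half [minn] does not grow
    from [i] to [i.+1], and the first summand suffices. *)
Lemma nbr_h_step a d i : i < d ->
  nbr_h a.+1 d i.+1 <= nbr_h a.+1 d i + nbr_h a d.+1 i.+1.
Proof.
move=> id; rewrite /nbr_h.
have [le2|lt2] := leqP i.+1.*2 d.
  have -> : minn i.+1 (d - i.+1) = i.+1 by lia.
  have -> : minn i (d - i) = i by lia.
  have -> : minn i.+1 (d.+1 - i.+1) = i.+1 by lia.
  by rewrite addSn binS addnC addSn addnS.
apply: leq_trans (leq_addr _ _); apply: (@leq_bin_diag a.+1); lia.
Qed.

(* Removing a dimension replaces the h-vector [h] by its successive differences,
   whose first half is the neighborly h-vector one dimension up and whose second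
   half is nonpositive. *)
Lemma nbr_sum_step a d k : k <= d ->
  \sum_(i < k.+1) nbr_h a.+1 d i * 'C(d - i, k - i) <=
  \sum_(i < k.+1) nbr_h a d.+1 i * 'C(d.+1 - i, k - i).
Proof.
case: k => [|k] kd.
  by rewrite !big_ord_recr !big_ord0 /= /nbr_h !min0n !bin0.
(* Adding this sum lets Pascal's rule raise d - i to d + 1 - i on the left; shifting its index by
   one on the right allows a termwise comparison by [nbr_h_step]. *)
rewrite -(leq_add2r (\sum_(i < k.+1) nbr_h a.+1 d i * 'C(d - i, k - i))).
rewrite [X in X + _ <= _]big_ord_recr /= subnn bin0 addnAC -big_split /=.
rewrite (eq_bigr (fun i : 'I_k.+1 => nbr_h a.+1 d i * 'C(d.+1 - i, k.+1 - i))).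
  have := big_ord_recr k.+1 (fun i : 'I_k.+2 => nbr_h a.+1 d i * 'C(d.+1 - i, k.+1 - i)).
  rewrite /= subnn bin0 => <-.
  rewrite big_ord_recl [X in _ <= X + _]big_ord_recl /=.
  rewrite -addnA; apply: leq_add; first by rewrite /nbr_h !min0n !bin0.
  rewrite -big_split /=; apply: leq_sum => i _.
  rewrite /bump /= !add1n !subSS -mulnDl leq_mul2r [X in _ <= X]addnC nbr_h_step ?orbT //.
  exact: leq_trans (ltn_ord i) kd.
move=> i _; have ik : i <= k by rewrite -ltnS.
rewrite -mulnDr (subSn ik) (subSn (leq_trans ik (ltnW kd))).
by rewrite binS addnC.
Qed.

(** Both sides belong to a + e + d + 1 vertices; each step trades one excess vertex for one
    dimension. *)
Lemma nbr_sum_mono a d e k : k <= d ->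
  \sum_(i < k.+1) nbr_h (a + e) d i * 'C(d - i, k - i) <=
  \sum_(i < k.+1) nbr_h a (d + e) i * 'C(d + e - i, k - i).
Proof.
elim: e a => [|e IH] a kd; first by rewrite !addn0.
rewrite addnS -addSn; apply: leq_trans (IH _ kd) _.
by rewrite addnS; apply: nbr_sum_step; rewrite (leq_trans kd) ?leq_addr.
Qed.

Lemma card_between (T : finType) (A B : {set T}) k : A \subset B ->
  #|[set S : {set T} | [&& A \subset S, S \subset B & #|S| == k]]| =
  if #|A| <= k then 'C(#|B| - #|A|, k - #|A|) else 0.
Proof.
move=> AB; case: leqP => Ak; last first.
  apply/eqP; rewrite cards_eq0 -subset0; apply/subsetP => S; rewrite !inE.
  case/and3P => /subset_leq_card AS _ /eqP Sk; lia.
rewrite -cardsDS // -cards_draws.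
rewrite -(card_in_imset (f := fun S => S :\: A)) => [|S S']; last first.
  rewrite !inE => /and3P[AS _ _] /and3P[AS' _ _] eqS.
  by rewrite -(setID S A) -(setID S' A) eqS (setIidPr AS) (setIidPr AS').
congr #|pred_of_set _|; apply/setP => S; rewrite inE; apply/imsetP/andP.
  move=> [U]; rewrite inE => /and3P[AU UB /eqP Uk] ->.
  by rewrite setSD // cardsDS // Uk.
move=> [SB /eqP Sk].
have dAS : [disjoint A & S].
  by rewrite disjoint_sym (disjointWl SB) // disjoints_subset subsetDr.
exists (A :|: S).
  rewrite inE subsetUl subUset AB (subset_trans SB (subsetDl _ _)) /=.
  by rewrite cardsU (disjoint_setI0 dAS) cards0 subn0 Sk subnKC.
rewrite setDUl setDv set0U; apply/esym/setDidPl.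
by rewrite disjoint_sym.
Qed.

(** * The upper bound theorem for simplicial polytopes *)

Local Open Scope ring_scope.

Lemma poly_nonroot (R : numDomainType) (q : {poly R}) (B : R) :
  q != 0 -> exists2 M, B < M & q.[M] != 0.
Proof.
move=> q0; pose s := [seq B + i.+1%:R | i <- iota 0 (size q)].
have us : uniq s.
  rewrite map_inj_uniq ?iota_uniq // => i j /addrI /eqP.
  by rewrite eqr_nat eqSS => /eqP.
have [rs|/allPn[_ /mapP[i _ ->] Nr]] := boolP (all (root q) s).
  by have := max_poly_roots q0 rs us; rewrite size_map size_iota ltnn.
by exists (B + i.+1%:R) => //; rewrite ltrDl.
Qed.

Lemma pos_lower_bound (R : realDomainType) (I : finType) (P : pred I) (b : I -> R) :
  (forall i, P i -> 0 < b i) -> exists2 e, 0 < e & forall i, P i -> e <= b i.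
Proof.
move=> b0; exists (\big[Num.min/1]_(i | P i) b i); first exact/lt_bigmin.
by move=> i Pi; apply: bigmin_le_cond.
Qed.

Section Polar.
Variables (R : realFieldType) (v d : nat) (X : 'M[R]_(v, d)).
Implicit Types (u w : 'cV[R]_d) (c : 'rV[R]_d) (a : 'rV[R]_v) (S F : {set 'I_v}).

Definition feasible u := [forall j, (X *m u) j 0 <= 1].

Definition tight u : {set 'I_v} := [set j | (X *m u) j 0 == 1].

(* A face of the convex hull of the rows of [X] is recorded by the set of rows
   it contains, or rather by any subset of it: in the simplicial case these
   are exactly the faces. *)
Definition face_set S := `[< exists2 u, feasible u & S \subset tight u >].

Definition facet F := `[< exists2 u, feasible u & tight u = F >] && (#|F| == d).

Definition nfaces k := #|[set S | face_set S & #|S| == k]|.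

(* The rows of [X] span, their centroid is the origin, and the proper faces of
   their convex hull are simplices. *)
Record simplicial := Simplicial {
  simplicial_centered : forall l, \sum_j X j l = 0;
  simplicial_full : forall u, X *m u = 0 -> u = 0;
  simplicial_free : forall u, feasible u -> forall a,
    (forall j, j \notin tight u -> a 0 j = 0) -> a *m X = 0 -> a = 0 }.

Lemma sum_mulmx_eq0 u : (forall l, \sum_j X j l = 0) -> \sum_j (X *m u) j 0 = 0.
Proof.
move=> X0; under eq_bigr do rewrite mxE.
by rewrite exchange_big big1 // => l _; rewrite -mulr_suml X0 mul0r.
Qed.

Hypothesis sX : simplicial.

Lemma small_step u w : feasible u -> (forall j, j \in tight u -> (X *m w) j 0 <= 0) ->
  exists2 e, 0 < e & feasible (u + e *: w) /\
    tight (u + e *: w) = [set j in tight u | (X *m w) j 0 == 0].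
Proof.
move=> /forallP fu wle0.
(* The summand 1 avoids a zero denominator and makes the bound on the step strict. *)
have slack j : j \notin tight u -> 0 < (1 - (X *m u) j 0) / (1 + `|(X *m w) j 0|).
  rewrite inE => Nj; apply: divr_gt0; last exact: ltr_pwDl.
  by rewrite subr_gt0 lt_neqAle Nj fu.
have [e e0 He] := pos_lower_bound slack; exists e => //.
have Xe j : (X *m (u + e *: w)) j 0 = (X *m u) j 0 + e * (X *m w) j 0.
  by rewrite mulmxDr -scalemxAr !mxE.
have lt1 j : j \notin tight u -> (X *m u) j 0 + e * (X *m w) j 0 < 1.
  move=> Nj; rewrite -ltrBrDl.
  have d0 : 0 < 1 + `|(X *m w) j 0| by apply: ltr_pwDl.
  have := He j Nj; rewrite ler_pdivlMr // => le1; apply: lt_le_trans le1.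
  by rewrite ltr_pM2l // (le_lt_trans (ler_norm _)) // ltrDr.
split.
  apply/forallP => j; rewrite Xe; have [jt|/lt1/ltW //] := boolP (j \in tight u).
  have := jt; rewrite inE => /eqP ->.
  by rewrite gerDl mulr_ge0_le0 // ?wle0 // ltW.
apply/setP => j; rewrite [in RHS]inE [in LHS]inE Xe.
have [jt|/lt1/lt_eqF //] := boolP (j \in tight u).
have := jt; rewrite inE => /eqP ->.
by rewrite -subr_eq0 addrAC subrr add0r mulf_eq0 gt_eqF.
Qed.

Definition rows_of F : 'M[R]_(#|F|, d) := rowsub (@enum_val _ (mem F)) X.

Lemma row_free_rows u F : feasible u -> F \subset tight u -> row_free (rows_of F).
Proof.
move=> fu Ft; apply: inj_row_free => b.
pose f : 'I_#|F| -> 'I_v := @enum_val _ (mem F).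
rewrite /rows_of rowsubE mulmxA => b0.
have {b0} := simplicial_free sX fu _ b0.
have bE j : (b *m rowsub f 1%:M) 0 j = \sum_(k | f k == j) b 0 k.
  rewrite mxE [RHS]big_mkcond; apply: eq_bigr => k _.
  by rewrite !mxE; case: eqP; rewrite (mulr1, mulr0).
move=> b0; apply/rowP => k.
have : (b *m rowsub f 1%:M) 0 (f k) = 0.
  rewrite b0 ?mxE // => j Nj; rewrite bE big1 // => l /eqP lj.
  by move: Nj; rewrite -lj (subsetP Ft) // enum_valP.
rewrite bE (big_pred1 k) ?mxE // => l /=.
by rewrite (inj_eq enum_val_inj).
Qed.

Lemma card_tight u : feasible u -> (#|tight u| <= d)%N.
Proof.
by move=> fu; have /eqP <- := row_free_rows fu (subxx _); apply: rank_leq_col.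
Qed.

(* As long as fewer than [d] constraints are tight, one can move along a line in
   the tight affine subspace until a new constraint becomes tight; the centroid
   being 0 makes the polar bounded. *)
Lemma climb u c : feasible u ->
  exists u', [/\ feasible u', tight u \subset tight u', #|tight u'| = d
               & (c *m u) 0 0 <= (c *m u') 0 0].
Proof.
have [m] := ubnP (d - #|tight u|); elim: m u => // m IH u.
rewrite ltnS => um fu; have := card_tight fu.
rewrite leq_eqVlt => /orP[/eqP tu|ltd]; first by exists u.
(* Fewer than d rows are tight, so they have a common kernel vector; its sign is chosen so that [c]
   does not decrease. *)
have [w [w0 Xw cw]] : exists w, [/\ w != 0, forall j, j \in tight u -> (X *m w) j 0 = 0
    & 0 <= (c *m w) 0 0].
  have [r /eqP r0 rX] : exists2 r : 'rV_d, r <> 0 & r *m (rows_of (tight u))^T = 0.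
    apply: contrapT => H; have : row_free (rows_of (tight u))^T.
      by apply: inj_row_free => r rX; apply: contrapT => r0; apply: H; exists r.
    move=> /eqP rk; have := rank_leq_col (rows_of (tight u))^T.
    by rewrite rk leqNgt ltd.
  have X0 j : j \in tight u -> (X *m r^T) j 0 = 0.
    move=> jt; have := congr1 (fun A : 'M_(_, _) => A 0 (enum_rank_in jt j)) rX.
    rewrite !mxE => rX0; rewrite -[RHS]rX0; apply: eq_bigr => l _.
    by rewrite !mxE mulrC enum_rankK_in.
  have [c0|c0] := leP 0 ((c *m r^T) 0 0).
    by exists r^T; split => //; rewrite trmx_eq0.
  exists (- r^T); split.
  - by rewrite oppr_eq0 trmx_eq0.
  - by move=> j /X0 Xj; rewrite mulmxN mxE Xj oppr0.
  - by rewrite mulmxN mxE oppr_ge0 ltW.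
(* The entries of X w sum to 0 without all vanishing, so the ray along [w] leaves the polar, first
   at the constraint minimizing [ratio]. *)
have [j1 j1P] : exists j, 0 < (X *m w) j 0.
  apply: contrapT => H.
  have le0 j : (X *m w) j 0 <= 0 by rewrite leNgt; apply/negP => Hj; apply: H; exists j.
  case/eqP: w0; apply: (simplicial_full sX); apply/colP => j; rewrite [RHS]mxE.
  apply/eqP; rewrite -oppr_eq0; apply/eqP; move: j (erefl true).
  have : \sum_j - (X *m w) j 0 = 0.
    by rewrite sumrN (sum_mulmx_eq0 _ (simplicial_centered sX)) oppr0.
  move/eqP; rewrite psumr_eq0 => [/allP H0 j _|j _]; last by rewrite oppr_ge0.
  by apply/eqP/H0; rewrite mem_index_enum.
pose ratio j := (1 - (X *m u) j 0) / (X *m w) j 0.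
have [j0 j0P minj] := @Order.TotalTheory.arg_minP _ _ _ j1 (fun j => 0 < (X *m w) j 0) ratio j1P.
have fu' := forallP fu.
have s0 : 0 <= ratio j0 by rewrite divr_ge0 // ?subr_ge0 // ltW.
set s := ratio j0 in minj s0.
have Xe j : (X *m (u + s *: w)) j 0 = (X *m u) j 0 + s * (X *m w) j 0.
  by rewrite mulmxDr -scalemxAr !mxE.
have fs : feasible (u + s *: w).
  apply/forallP => j; rewrite Xe -lerBrDl.
  have [j_gt0|j_le0] := ltP 0 ((X *m w) j 0).
    by rewrite -ler_pdivlMr // minj.
  by rewrite (@le_trans _ _ 0) ?subr_ge0 // mulr_ge0_le0.
have sub : tight u \subset tight (u + s *: w).
  apply/subsetP => j jt; have := jt; rewrite !inE Xe => /eqP ->.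
  by rewrite Xw // mulr0 addr0.
have j0t : j0 \in tight (u + s *: w).
  by rewrite inE Xe /s /ratio (divfK (lt0r_neq0 j0P)) addrC subrK.
have j0u : j0 \notin tight u.
  by apply/negP => /Xw j00; move: j0P; rewrite j00 ltxx.
have lt : (#|tight u| < #|tight (u + s *: w)|)%N.
  apply: proper_card; rewrite properE sub; apply/subsetPn.
  by exists j0.
have [|u' [fu1 sub1 tu1 cu1]] := IH _ _ fs.
  by have := card_tight fs; lia.
exists u'; split => //; first exact: subset_trans sub1.
apply: le_trans cu1.
have -> : (c *m (u + s *: w)) 0 0 = (c *m u) 0 0 + s * (c *m w) 0 0.
  by rewrite mulmxDr -scalemxAr !mxE.
by rewrite lerDl mulr_ge0.
Qed.

(** For a facet [F], [c *m coordmx F] lists the coordinates of [c] in the basis of rows in [F],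
    padded with zeros; the columns in [F] form the dual basis. *)
Definition coordmx F : 'M[R]_(d, v) :=
  pinvmx (rows_of F) *m rowsub (@enum_val _ (mem F)) 1%:M.

Lemma facetP F : reflect (exists u, [/\ feasible u, tight u = F & #|F| = d]) (facet F).
Proof.
apply: (iffP andP) => [[/asboolP[u fu tu] /eqP cF]|[u [fu tu cF]]]; first by exists u.
by split; [apply/asboolP; exists u | apply/eqP].
Qed.

Lemma facet_card F : facet F -> #|F| = d.
Proof. by case/facetP => u []. Qed.

Lemma coordmx_mul F : facet F -> coordmx F *m X = 1%:M.
Proof.
case/facetP => u [fu tu cF].
rewrite -mulmxA -rowsubE mulVpmx //.
have /eqP rk : row_free (rows_of F) by apply: (row_free_rows fu); rewrite tu.
by rewrite /row_full rk cF.
Qed.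

Lemma coordmx_out F j i : j \notin F -> coordmx F i j = 0.
Proof.
move=> Nj; rewrite mxE big1 // => k _; rewrite !mxE.
case: eqP => [kj|]; rewrite ?mulr0 //.
by move: Nj; rewrite -kj enum_valP.
Qed.

Lemma coordmx_row F j : facet F -> j \in F -> row j X *m coordmx F = delta_mx 0 j.
Proof.
move=> fF jF; have /facetP[u [fu tu _]] := fF.
apply/eqP; rewrite -subr_eq0; apply/eqP; apply: (simplicial_free sX fu).
  move=> l; rewrite tu => Nl; rewrite !mxE big1 => [|k _]; last first.
    by rewrite coordmx_out // mulr0.
  by have [lj|_] := eqVneq l j; [rewrite lj jF in Nl | rewrite andbF subr0].
by rewrite mulmxBl -mulmxA coordmx_mul // mulmx1 rowE subrr.
Qed.

Definition bcoef c F j := (c *m coordmx F) 0 j.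

Lemma bcoef_out c F j : j \notin F -> bcoef c F j = 0.
Proof. by move=> Nj; rewrite /bcoef mxE big1 // => k _; rewrite coordmx_out // mulr0. Qed.

Lemma bcoefD c c' F j : bcoef (c + c') F j = bcoef c F j + bcoef c' F j.
Proof. by rewrite /bcoef mulmxDl mxE. Qed.

Lemma bcoefZ k c F j : bcoef (k *: c) F j = k * bcoef c F j.
Proof. by rewrite /bcoef -scalemxAl mxE. Qed.

Lemma bcoef_row F i j : facet F -> i \in F -> bcoef (row i X) F j = (j == i)%:R.
Proof. by move=> fF iF; rewrite /bcoef coordmx_row // mxE eqxx. Qed.

Lemma bcoef_apply c F u : facet F -> (c *m u) 0 0 = \sum_(j in F) bcoef c F j * (X *m u) j 0.
Proof.
move=> fF; rewrite -{1}[c]mulmx1 -(coordmx_mul fF) (mulmxA c) -[_ *m u]mulmxA mxE.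
rewrite [RHS]big_mkcond; apply: eq_bigr => j _.
by case: ifPn => // /(bcoef_out c); rewrite /bcoef => ->; rewrite mul0r.
Qed.

(** From the vertex of [F], this direction releases the constraints in [S] at unit rate and keeps
    the others of [F] tight. *)
Definition edge F S : 'cV[R]_d := - \sum_(j in S) col j (coordmx F).

Lemma edgeE F S l : facet F -> l \in F -> (X *m edge F S) l 0 = - (l \in S)%:R.
Proof.
move=> fF lF; have XE j : (X *m col j (coordmx F)) l 0 = (j == l)%:R.
  by rewrite -(bcoef_row j fF lF) /bcoef !mxE; apply: eq_bigr => k _; rewrite !mxE.
rewrite mulmxN mxE mulmx_sumr summxE; congr (- _).
under eq_bigr do rewrite XE.
have [lS|NlS] := boolP (l \in S).
  by rewrite (bigD1 l) //= eqxx big1 ?addr0 // => j /andP[_ /negPf ->].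
by rewrite big1 // => j jS; case: eqP => // jl; rewrite -jl jS in NlS.
Qed.

(** Climb to a vertex of the polar, then step back so as to release exactly the constraints in
    [F :\: S]. *)
Lemma face_exact S : face_set S -> exists2 u, feasible u & tight u = S.
Proof.
case/asboolP => u0 fu0 Su0; have [u [fu sub cu _]] := climb 0 fu0.
have fF : facet (tight u) by apply/facetP; exists u.
set F := tight u in sub cu fF.
have SF : S \subset F by apply: subset_trans sub.
have [|e _ [fe te]] := small_step (w := edge F (F :\: S)) fu.
  by move=> j jF; rewrite edgeE // oppr_le0.
exists (u + e *: edge F (F :\: S)) => //; rewrite te.
apply/setP => j; rewrite inE -/F; have [jF|NjF] := boolP (j \in F); last first.
  by apply/esym/negP => /(subsetP SF); apply/negP.
by rewrite edgeE // inE jF andbT oppr_eq0; case: (j \in S) => /=; rewrite ?eqxx ?oner_eq0.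
Qed.

Lemma facet_face F S : facet F -> S \subset F -> face_set S.
Proof. by case/facetP => u [fu tu _] SF; apply/asboolP; exists u; rewrite ?tu. Qed.

(** * Generic functionals and the h-vector *)

Definition generic c := forall F j, facet F -> j \in F -> bcoef c F j != 0.

Definition neg c F := [set j in F | bcoef c F j < 0].

Definition hnum c i := #|[set F | facet F & #|neg c F| == i]|.

Definition vertex_value c F := \sum_(j in F) bcoef c F j.

Lemma vertex_valueE c F u : facet F -> tight u = F -> (c *m u) 0 0 = vertex_value c F.
Proof.
move=> fF tu; rewrite (bcoef_apply _ _ fF); apply: eq_bigr => j.
by rewrite -tu inE => /eqP ->; rewrite mulr1.
Qed.

(* [neg c F \subset S \subset F] says that [F] is the optimum of the linear
   program maximizing [c] over the face of the polar cut out by [S]. *)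
Lemma optimal_facet_exists c S : generic c -> face_set S ->
  exists F, [/\ facet F, neg c F \subset S & S \subset F].
Proof.
move=> gc /asboolP[u0 fu0 Su0].
have facet_above u : feasible u -> S \subset tight u -> exists F,
    [/\ facet F, S \subset F & (c *m u) 0 0 <= vertex_value c F].
  move=> fu Su; have [u' [fu' sub cu' le]] := climb c fu.
  have fF : facet (tight u') by apply/facetP; exists u'.
  by exists (tight u'); rewrite -(vertex_valueE c fF erefl) fF (subset_trans Su).
have [F0 [fF0 SF0 _]] := facet_above _ fu0 Su0.
have P0 : facet F0 && (S \subset F0) by rewrite fF0.
have [F /andP[fF SF] maxF] := @Order.TotalTheory.arg_maxP _ _ _ F0
  (fun F => facet F && (S \subset F)) (vertex_value c) P0.
exists F; split => //; apply/subsetP => j; rewrite inE => /andP[jF cj].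
(* A negative coordinate [j] outside [S] would make [c] increase along the edge releasing only [j];
   climbing from there would give a better facet. *)
apply: contraT => NjS; have /facetP[u [fu tu _]] := fF.
have [|e e0 [fe te]] := small_step (w := edge F [set j]) fu.
  by move=> l; rewrite tu => lF; rewrite edgeE // oppr_le0.
have Se : S \subset tight (u + e *: edge F [set j]).
  apply/subsetP => l lS; have lF := subsetP SF _ lS.
  rewrite te inE tu lF edgeE // inE.
  by have [lj|] := eqVneq l j; [rewrite -lj lS in NjS | rewrite oppr0 eqxx].
have [F' [fF' SF' le']] := facet_above _ fe Se.
have /= := maxF F'; rewrite fF' SF' => /(_ isT) /=; rewrite leNgt; case/negP.
apply: lt_le_trans le'; rewrite -(vertex_valueE c fF tu).
have -> : (c *m (u + e *: edge F [set j])) 0 0 = (c *m u) 0 0 + e * (c *m edge F [set j]) 0 0.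
  by rewrite mulmxDr -scalemxAr !mxE.
rewrite ltrDl mulr_gt0 //.
rewrite (bcoef_apply _ _ fF) (bigD1 j) //= edgeE // inE eqxx big1 => [|l /andP[lF /negPf lj]].
  by rewrite addr0 mulrN1 oppr_gt0.
by rewrite edgeE // inE lj oppr0 mulr0.
Qed.

(** At the vertex of [F'], [c] is the sum of its coordinates in [F] weighted by the constraint
    values. These are 1 on [S] and at most 1 elsewhere, where the coordinates are positive. *)
Lemma optimal_value_le c S F F' : generic c -> facet F -> facet F' ->
  neg c F \subset S -> S \subset F -> S \subset F' ->
  vertex_value c F' <= vertex_value c F ?= iff (F \subset F').
Proof.
move=> gc fF fF' NS SF SF'; have /facetP[u [/forallP fu tu _]] := fF'.
rewrite -(vertex_valueE c fF' tu) (bcoef_apply _ _ fF) /vertex_value.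
have -> : (F \subset F') = [forall (j | j \in F), j \in F'].
  by apply/subsetP/forall_inP.
apply: leif_sum => j jF; have [jS|NjS] := boolP (j \in S).
  have jF' := subsetP SF' _ jS.
  have /eqP -> : (X *m u) j 0 == 1 by move: jF'; rewrite -tu inE.
  by rewrite mulr1 jF'; apply/leif_refl.
have cj : 0 < bcoef c F j.
  rewrite lt_neqAle eq_sym gc //= leNgt; apply/negP => cj.
  by move: NjS; rewrite (subsetP NS) // inE jF.
split; first by rewrite ger_pMr // fu.
rewrite -subr_eq0 -{2}[bcoef c F j]mulr1 -mulrBr mulf_eq0 gt_eqF //= subr_eq0.
by rewrite -tu inE.
Qed.

Lemma optimal_facet_unique c S F F' : generic c -> facet F -> facet F' ->
  neg c F \subset S -> S \subset F -> neg c F' \subset S -> S \subset F' -> F = F'.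
Proof.
move=> gc fF fF' NS SF NS' SF'.
have [le1 eq1] := optimal_value_le gc fF fF' NS SF SF'.
have [le2 _] := optimal_value_le gc fF' fF NS' SF' SF.
move: eq1; rewrite (@le_anti _ _ (vertex_value c F') (vertex_value c F)) ?le1 ?le2 //.
rewrite eqxx => /esym FF'; apply/eqP; rewrite eqEcard FF'.
by rewrite (facet_card fF) (facet_card fF') leqnn.
Qed.

(** Double counting: each face has exactly one optimal facet, and a facet with i negative
    coordinates is optimal for the C(d-i, k-i) sets of size k between [neg c F] and [F]. *)
Lemma nfacesE c k : generic c -> (k <= d)%N ->
  nfaces k = (\sum_(i < k.+1) hnum c i * 'C(d - i, k - i))%N.
Proof.
move=> gc kd.
transitivity (\sum_(S | face_set S && (#|S| == k))
   \sum_(F | facet F) ((neg c F \subset S) && (S \subset F) : nat))%N.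
  rewrite /nfaces -sum1dep_card; apply: eq_bigr => S /andP[fS _].
  have [F [fF NS SF]] := optimal_facet_exists gc fS.
  rewrite (bigD1 F) //= NS SF big1 // => F' /andP[fF' F'F].
  apply/eqP; rewrite eqb0; apply: contra F'F => /andP[NS' SF'].
  by rewrite (optimal_facet_unique gc fF' fF NS' SF' NS SF).
rewrite exchange_big /=.
under [RHS]eq_bigr => i _.
  rewrite /hnum -sum1dep_card big_distrl /= big_mkcondr /=.
  over.
rewrite [RHS]exchange_big /=; apply: eq_bigr => F fF.
transitivity #|[set S : {set 'I_v} | [&& neg c F \subset S, S \subset F & #|S| == k]]|.
  rewrite -sum1dep_card big_mkcond [RHS]big_mkcond; apply: eq_bigr => S _.
  have [NS|] := boolP (neg c F \subset S); last by case: ifP.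
  have [SF|] := boolP (S \subset F); last by case: ifP.
  by rewrite (facet_face fF SF).
rewrite card_between; last by apply/subsetP => j; rewrite inE => /andP[].
rewrite (facet_card fF) -ltnS.
rewrite -(big_ord1_eq addn (fun i => 'C(d - i, k - i))).
rewrite big_mkcond; apply: eq_bigr => i _.
by rewrite mul1n eq_sym.
Qed.

(** The relevant coordinates of [c + M *: y] are nonzero polynomials of degree at most 1 in [M], so
    [M] only has to avoid the roots of their product. *)
Lemma generic_line c y B :
  (forall F j, facet F -> j \in F -> (bcoef c F j != 0) || (bcoef y F j != 0)) ->
  exists2 M, B < M & generic (c + M *: y).
Proof.
move=> H.
pose q := \prod_(p : {set 'I_v} * 'I_v | facet p.1 && (p.2 \in p.1))
  ((bcoef c p.1 p.2)%:P + bcoef y p.1 p.2 *: 'X).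
have q0 : q != 0.
  apply/prodf_neq0 => -[F j] /= /andP[fF jF].
  apply: contraTneq (H F j fF jF) => q0.
  have := congr1 (fun r : {poly R} => r`_0) q0; have := congr1 (fun r : {poly R} => r`_1) q0.
  rewrite /= !coefD !coefC !coefZ !coefX ?coef0 /= mulr1 mulr0 add0r addr0 => -> ->.
  by rewrite eqxx.
have [M BM qM] := poly_nonroot B q0; exists M => // F j fF jF.
move: qM; rewrite horner_prod => /prodf_neq0 /(_ (F, j)).
rewrite /= fF jF => /(_ isT); rewrite hornerD hornerC hornerZ hornerX.
by rewrite bcoefD bcoefZ mulrC.
Qed.

(* A generic point of the moment curve. *)
Lemma generic_exists : exists c, generic c.
Proof.
pose q := \prod_(p : {set 'I_v} * 'I_v | facet p.1 && (p.2 \in p.1))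
  \sum_(i < d) coordmx p.1 i p.2 *: 'X^i.
have q0 : q != 0.
  apply/prodf_neq0 => -[F j] /= /andP[fF jF]; apply/eqP => q0.
  have G0 i : coordmx F i j = 0.
    have := congr1 (fun r : {poly R} => r`_i) q0.
    rewrite coef_sum coef0 (bigD1 i) //= coefZ coefXn eqxx mulr1 big1 ?addr0 // => k ki.
    by rewrite coefZ coefXn (inj_eq val_inj) eq_sym (negPf ki) mulr0.
  have := bcoef_row j fF jF; rewrite /bcoef mxE eqxx big1 => [/eqP|k _].
    by rewrite eq_sym oner_eq0.
  by rewrite G0 mulr0.
have [M _ qM] := poly_nonroot 0 q0; exists (\row_i M ^+ i) => F j fF jF.
move: qM; rewrite horner_prod => /prodf_neq0 /(_ (F, j)).
rewrite /= fF jF => /(_ isT); rewrite horner_sum /bcoef mxE.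
congr (_ != 0); apply: eq_bigr => i _.
by rewrite hornerZ hornerXn mulrC; congr (_ * _); rewrite mxE.
Qed.

Lemma hnum_indep c c' i : generic c -> generic c' -> (i <= d)%N -> hnum c i = hnum c' i.
Proof.
move=> gc gc'; apply: (@hvec_unique d d) => // k kd.
by rewrite -!nfacesE.
Qed.

Lemma neg_sub c F : neg c F \subset F.
Proof. by apply/subsetP => j; rewrite inE => /andP[]. Qed.

Lemma hnum_sym c i : generic c -> (i <= d)%N -> hnum c i = hnum c (d - i)%N.
Proof.
move=> gc id.
have cN F j : bcoef (- c) F j = - bcoef c F j by rewrite -scaleN1r bcoefZ mulN1r.
have gN : generic (- c) by move=> F j fF jF; rewrite cN oppr_eq0 gc.
rewrite (hnum_indep gc gN) //; congr #|pred_of_set _|; apply/setP => F; rewrite !inE.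
have [fF /=|//] := boolP (facet F).
have -> : neg (- c) F = F :\: neg c F.
  apply/setP => j; rewrite !inE cN oppr_lt0; have [jF|] /= := boolP (j \in F).
    by rewrite -leNgt le_eqVlt eq_sym (negPf (gc F j fF jF)) andbT.
  by [].
rewrite cardsDS ?neg_sub // (facet_card fF).
have := subset_leq_card (neg_sub c F); rewrite (facet_card fF) => nd.
have E (m : nat) : (m <= d)%N -> ((d - m)%N == i) = (m == (d - i)%N) by lia.
exact: E.
Qed.

(* Tilting the functional towards [row x X] makes the facets through [x] come
   first without changing the signs of their other coefficients. *)
Lemma link_le c x i : generic c -> (i <= d)%N ->
  (#|[set F | [&& facet F, x \in F & #|neg c F :\ x| == i]]| <= hnum c i)%N.
Proof.
move=> gc id.
(* This bound dominates the coordinate at [x] in all facets at once, so tilting makes it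
   nonnegative. *)
have [|M BM gM] := @generic_line c (row x X) (\sum_F `|bcoef c F x|).
  by move=> F j fF jF; rewrite gc.
rewrite (hnum_indep gc gM) //; apply/subset_leq_card/subsetP => F; rewrite !inE.
case/and3P => fF xF; rewrite fF /=; congr (_ == i); congr #|pred_of_set _|.
apply/setP => j; rewrite !inE; have [jF|] /= := boolP (j \in F); last by rewrite andbF.
rewrite bcoefD bcoefZ bcoef_row //; have [->|] /= := eqVneq j x; last first.
  by rewrite mulr0 addr0.
apply/esym/negbTE; rewrite -leNgt mulr1 -lerBlDl sub0r (le_trans (ler_norm _)) // normrN.
by rewrite (le_trans _ (ltW BM)) // (bigD1 F) //= lerDl sumr_ge0.
Qed.

(** Sum [link_le] over [x]: a facet with i negative coordinates is counted at its d-i points outside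
    [neg c F], one with i+1 at each of its i+1 points in [neg c F]. *)
Lemma hnum_rec c i : generic c -> (i < d)%N ->
  ((d - i) * hnum c i + i.+1 * hnum c i.+1 <= v * hnum c i)%N.
Proof.
move=> gc id.
have : (\sum_(x < v) #|[set F | [&& facet F, x \in F & #|neg c F :\ x| == i]]|
         <= v * hnum c i)%N.
  rewrite -[X in (_ <= X * _)%N]card_ord -sum_nat_const.
  by apply: leq_sum => x _; apply: link_le => //; apply: ltnW.
apply: leq_trans.
under eq_bigr do rewrite -sum1dep_card big_mkcondr.
have hE l : hnum c l = (\sum_(F | facet F) (#|neg c F| == l))%N.
  by rewrite /hnum -sum1dep_card big_mkcondr.
rewrite exchange_big /= !hE !big_distrr -big_split /=.
apply: leq_sum => F fF; rewrite -big_mkcond sum1dep_card.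
have cN j : #|neg c F| = ((j \in neg c F) + #|neg c F :\ j|)%N by rewrite (cardsD1 j).
have [Ni|_] := eqVneq #|neg c F| i.
  have -> : (#|neg c F| == i.+1) = false by rewrite Ni ltn_eqF.
  rewrite /= muln1 muln0 addn0 -(facet_card fF) -Ni -cardsDS ?neg_sub //.
  apply/subset_leq_card/subsetP => j; rewrite in_setD => /andP[Nj jF].
  by rewrite inE jF /= (cN j) (negPf Nj).
have [Ni|_] := eqVneq #|neg c F| i.+1; last by rewrite !muln0.
rewrite /= muln0 muln1 add0n -{1}Ni; apply/subset_leq_card/subsetP => j Nj; rewrite inE.
rewrite (subsetP (neg_sub c F)) //=; have := cN j; rewrite Ni Nj add1n.
by case=> <-.
Qed.

Lemma hnum0_le c : generic c -> (hnum c 0 <= 1)%N.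
Proof.
move=> gc; have := nfacesE gc (leq0n d); rewrite big_ord1 bin0 muln1 => <-.
rewrite -(cards1 (set0 : {set 'I_v})); apply/subset_leq_card/subsetP => S.
by rewrite !inE cards_eq0 => /andP[].
Qed.

(** Since v - (d - i) = a + i + 1, [hnum_rec] bounds (i+1) h_(i+1) by (a+i+1) h_i, and C(a+i, i)
    satisfies this recurrence with equality. *)
Lemma hnum_le c (a i : nat) : generic c -> v = (a + d).+1 -> (i <= d)%N ->
  (hnum c i <= 'C(a + i, i))%N.
Proof.
move=> gc va; elim: i => [|i IH] id; first by rewrite bin0 hnum0_le.
have hr := hnum_rec gc id; have hi := IH (ltnW id).
have binE : ((a + i).+1 * 'C(a + i, i) = i.+1 * 'C(a + i.+1, i.+1))%N.
  by rewrite addnS -mul_bin_diag.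
rewrite -(leq_pmul2l (ltn0Sn i)) -binE; rewrite [X in (_ <= X * _)%N]va in hr.
have : ((a + i).+1 * hnum c i <= (a + i).+1 * 'C(a + i, i))%N by rewrite leq_mul2l hi orbT.
apply: leq_trans; rewrite -(leq_add2l ((d - i) * hnum c i)) -mulnDl (leq_trans hr) //.
by rewrite leq_mul2r; apply/orP; right; lia.
Qed.

Lemma hnum_le_nbr c (a i : nat) : generic c -> v = (a + d).+1 -> (i <= d)%N ->
  (hnum c i <= nbr_h a d i)%N.
Proof.
move=> gc va id; rewrite /nbr_h; case: (leqP i (d - i)) => _; first exact: hnum_le.
by rewrite hnum_sym // hnum_le // leq_subr.
Qed.

Lemma nfaces_le (a k : nat) : v = (a + d).+1 -> (k <= d)%N ->
  (nfaces k <= \sum_(i < k.+1) nbr_h a d i * 'C(d - i, k - i))%N.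
Proof.
move=> va kd; have [c gc] := generic_exists.
rewrite (nfacesE gc) //; apply: leq_sum => i _; rewrite leq_mul2r hnum_le_nbr ?orbT //.
by rewrite (leq_trans _ kd) // -ltnS.
Qed.

(** The face numbers up to d/2 determine the h-numbers up to d/2, which [sum_bin_conv] identifies;
    symmetry gives the other half. *)
Lemma nfaces_neighborly (a k : nat) : v = (a + d).+1 ->
  (forall j, (j.*2 <= d)%N -> nfaces j = 'C(v, j)) -> (k <= d)%N ->
  nfaces k = (\sum_(i < k.+1) nbr_h a d i * 'C(d - i, k - i))%N.
Proof.
move=> va nbr kd; have [c gc] := generic_exists.
have low i : (i <= d./2)%N -> hnum c i = 'C(a + i, i).
  apply: (@hvec_unique d./2 d (hnum c) (fun l => 'C(a + l, l))) => [|j jd]; first by lia.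
  have jd' : (j <= d)%N by lia.
  by rewrite /= -nfacesE // sum_bin_conv // nbr ?va //; lia.
rewrite (nfacesE gc) //; apply: eq_bigr => i _; congr (_ * _)%N; rewrite /nbr_h.
have id : (i <= d)%N by rewrite (leq_trans _ kd) // -ltnS.
case: (leqP i (d - i)) => le; first by rewrite low //; lia.
by rewrite hnum_sym // low //; lia.
Qed.

Lemma nfaces_gt k : (d < k)%N -> nfaces k = 0%N.
Proof.
move=> dk; apply/eqP; rewrite cards_eq0 -subset0; apply/subsetP => S; rewrite inE.
case/andP => /asboolP[u fu /subset_leq_card Su] /eqP Sk.
by have := card_tight fu; lia.
Qed.

End Polar.

(** * The lasso polytope *)

Lemma ge0_of_quadratic (R : realFieldType) (B a q : R) : 0 < B -> 0 <= q ->
  (forall s, 0 < s -> s <= B -> 0 <= s * a + s ^+ 2 * q) -> 0 <= a.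
Proof.
move=> B0 q0 H; rewrite leNgt; apply/negP => a0.
have q1 : 0 < q + 1 by rewrite ltr_wpDl.
(* For this [s], a + s q <= - s < 0, against the hypothesis. *)
pose s := Num.min B (- a / (q + 1)).
have s0 : 0 < s by rewrite lt_min B0 divr_gt0 ?oppr_gt0.
have sB : s <= B by rewrite ge_min lexx.
have sa : s * (q + 1) <= - a by rewrite -ler_pdivlMr // ge_min lexx orbT.
have := H s s0 sB; rewrite expr2 -mulrA -mulrDr pmulr_rge0 //.
nra.
Qed.

Section LassoPolytope.
Variables (R : realType) (n p : nat) (X0 : 'M[R]_(n, p)) (lambda : R).
Hypothesis lambda_gt0 : 0 < lambda.

Lemma sqnorm2_ge0 m (w : 'cV[R]_m) : 0 <= sqnorm2 w.
Proof. by apply: sumr_ge0 => i _; apply: sqr_ge0. Qed.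

Lemma sqnorm2B m (r w : 'cV[R]_m) :
  sqnorm2 (r - w) = sqnorm2 r - 2 * (r^T *m w) 0 0 + sqnorm2 w.
Proof.
rewrite /sqnorm2 !mxE mulr_sumr -sumrB -big_split /=; apply: eq_bigr => i _.
by rewrite !mxE; ring.
Qed.

Lemma signed_objective_shift y b j s (D := signed_design X0) :
  signed_objective X0 lambda y (b + s *: delta_mx j 0) =
  signed_objective X0 lambda y b
  + (s * (lambda - (D^T *m (y - D *m b)) j 0) + s ^+ 2 * (2^-1 * sqnorm2 (col j D))).
Proof.
rewrite /signed_objective -/D mulmxDr opprD addrA -scalemxAr -colE.
rewrite sqnorm2B.
have -> : ((y - D *m b)^T *m (s *: col j D)) 0 0 = s * (D^T *m (y - D *m b)) j 0.
  rewrite -scalemxAr mxE; congr (_ * _).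
  by rewrite !mxE; apply: eq_bigr => i _; rewrite !mxE mulrC.
have -> : sqnorm2 (s *: col j D) = s ^+ 2 * sqnorm2 (col j D).
  by rewrite /sqnorm2 mulr_sumr; apply: eq_bigr => i _; rewrite mxE exprMn.
have -> : \sum_i (b + s *: delta_mx j 0) i 0 = \sum_i b i 0 + s.
  under eq_bigr do rewrite mxE.
  rewrite big_split /=; congr (_ + _).
  rewrite (bigD1 j) //= !mxE !eqxx mulr1 big1 ?addr0 // => i /negPf ij.
  by rewrite !mxE ij mulr0.
by field.
Qed.

(** First-order conditions along the axes: any coordinate may be increased, and a positive one may
    be decreased by at most its value. *)
Lemma signed_kkt y b (D := signed_design X0) : is_signed_solution X0 lambda y b ->
  (forall j, (D^T *m (y - D *m b)) j 0 <= lambda) /\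
  (forall j, 0 < b j 0 -> (D^T *m (y - D *m b)) j 0 = lambda).
Proof.
case=> b0 min_b; have {}b0 i : 0 <= b i 0 by exact: b0.
have q0 j : 0 <= 2^-1 * sqnorm2 (col j D) by rewrite mulr_ge0 ?sqnorm2_ge0 ?invr_ge0.
have cone j s : 0 <= b j 0 + s -> nonneg_cone (b + s *: delta_mx j 0).
  move=> bs i; rewrite !mxE; have [->|] := eqVneq i j; first by rewrite mulr1.
  by rewrite mulr0 addr0.
have step j s : 0 <= b j 0 + s ->
    0 <= s * (lambda - (D^T *m (y - D *m b)) j 0) + s ^+ 2 * (2^-1 * sqnorm2 (col j D)).
  by move=> /cone /min_b; rewrite signed_objective_shift lerDl.
have le j : (D^T *m (y - D *m b)) j 0 <= lambda.
  rewrite -subr_ge0; apply: (ge0_of_quadratic ltr01 (q0 j)) => s s0 _; apply: step.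
  by rewrite addr_ge0 ?b0 ?ltW.
split=> // j bj; apply/eqP; rewrite eq_le le -subr_le0 -oppr_ge0.
apply: (ge0_of_quadratic bj (q0 j)) => s s0 sb.
have := step j (- s); rewrite subr_ge0 => /(_ sb).
by rewrite sqrrN mulNr mulrN.
Qed.

(** The vector [z] is a dual certificate: its image under [X0^T] is a subgradient of [norm1] at [b],
    and the objective is convex. *)
Lemma lasso_argmin (y z : 'cV[R]_n) (b : 'cV[R]_p) :
  (forall j, `|(X0^T *m z) j 0| <= 1) -> y - X0 *m b = lambda *: z ->
  norm1 b = \sum_j (X0^T *m z) j 0 * b j 0 ->
  is_argmin classical_sets.setT (lasso_objective X0 lambda y) b.
Proof.
move=> g1 yb nb; split=> // b' _; rewrite /lasso_objective.
have -> : y - X0 *m b' = lambda *: z - X0 *m (b' - b).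
  by rewrite -yb mulmxBr opprB addrA subrK.
rewrite yb sqnorm2B.
have -> : ((lambda *: z)^T *m (X0 *m (b' - b))) 0 0 =
    lambda * (\sum_j (X0^T *m z) j 0 * b' j 0 - norm1 b).
  have -> : (lambda *: z)^T *m (X0 *m (b' - b)) = lambda *: ((X0^T *m z)^T *m (b' - b)).
    by rewrite trmx_mul trmxK linearZ /= -scalemxAl mulmxA.
  rewrite mxE nb -sumrB; congr (_ * _); rewrite mxE; apply: eq_bigr => j _.
  by rewrite [in LHS]mxE [(b' - b) _ _]mxE [(- b) _ _]mxE mulrBr.
have le : \sum_j (X0^T *m z) j 0 * b' j 0 <= norm1 b'.
  apply: ler_sum => j _; apply: le_trans (ler_norm _) _.
  by rewrite normrM ler_piMl.
have := sqnorm2_ge0 (X0 *m (b' - b)).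
have := ler_wpM2l (ltW lambda_gt0) le.
by lra.
Qed.

(** The columns of (X0, -X0), in coordinates relative to [col_base X0] so that they span the whole
    space. *)
Definition lasso_points : 'M[R]_(p + p, \rank X0) :=
  (row_mx (row_base X0) (- row_base X0))^T.

Lemma lasso_points_lift (z : 'cV[R]_n) :
  lasso_points *m ((col_base X0)^T *m z) = (signed_design X0)^T *m z.
Proof.
rewrite /lasso_points mulmxA -trmx_mul mul_mx_row mulmxN mulmx_base.
by [].
Qed.

Lemma lasso_points_surj (u : 'cV[R]_(\rank X0)) : exists z, (col_base X0)^T *m z = u.
Proof.
exists (u^T *m pinvmx (col_base X0))^T.
by rewrite -trmx_mul -mulmxA mulVpmx ?col_base_full // mulmx1 trmxK.
Qed.

(** A dependence [a] among tight points folds into a kernel vector [e] of [X0]. For a response with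
    certificate [z], both [s] and [s + t *: e] are minimizers, so e = 0. A column and its negative
    are never tight together, hence a = 0. *)
Lemma lasso_points_simplicial : lasso_unique X0 lambda -> simplicial lasso_points.
Proof.
move=> uniq; split.
- move=> l; rewrite big_split_ord /=.
  have -> : \sum_i lasso_points (rshift p i) l = - \sum_i lasso_points (lshift p i) l.
    rewrite -sumrN; apply: eq_bigr => i _.
    by rewrite [LHS]mxE row_mxEr [LHS]mxE [in RHS]mxE row_mxEl.
  by rewrite subrr.
- move=> u; rewrite /lasso_points tr_row_mx mul_col_mx => /eqP.
  rewrite col_mx_eq0 => /andP[/eqP u0 _].
  apply: trmx_inj; rewrite trmx0; apply/eqP.
  rewrite -(mulmx_free_eq0 _ (row_base_free X0)).
  by rewrite -[row_base X0]trmxK -trmx_mul u0 trmx0.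
move=> u fu a asupp aX.
have [z zu] := lasso_points_surj u.
pose g : 'cV[R]_p := X0^T *m z.
have XL j : (lasso_points *m u) (lshift p j) 0 = g j 0.
  by rewrite -zu lasso_points_lift /signed_design tr_row_mx mul_col_mx col_mxEu.
have XR j : (lasso_points *m u) (rshift p j) 0 = - g j 0.
  rewrite -zu lasso_points_lift /signed_design tr_row_mx mul_col_mx col_mxEd.
  by rewrite linearN /= mulNmx mxE.
have g1 j : `|g j 0| <= 1.
  have /forallP f := fu; by rewrite ler_norml lerNl -XR -XL !f.
have aL j : g j 0 != 1 -> a 0 (lshift p j) = 0.
  by move=> gj; apply: asupp; rewrite inE XL.
have aR j : g j 0 != -1 -> a 0 (rshift p j) = 0.
  by move=> gj; apply: asupp; rewrite inE XR eqr_oppLR.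
pose e : 'cV[R]_p := \col_j (a 0 (lshift p j) - a 0 (rshift p j)).
have Xe : X0 *m e = 0.
  have : row_base X0 *m e = 0.
    have -> : e = (lsubmx a)^T - (rsubmx a)^T by apply/colP => j; rewrite !mxE.
    have := congr1 trmx aX; rewrite trmx_mul trmxK trmx0 -[a]hsubmxK tr_row_mx.
    by rewrite mul_row_col mulNmx row_mxKl row_mxKr mulmxBr.
  by move=> e0; rewrite -(mulmx_base X0) -mulmxA e0 mulmx0.
(* Where a constraint is tight the entry is 1 or -1, so a change of size at most 1 there produces no
   sign opposite to [g]. *)
pose s : 'cV[R]_p := \col_j (if `|g j 0| == 1 then g j 0 else 0).
pose y := lambda *: z + X0 *m s.
have argmin (t : R) : (forall j, `|t * e j 0| <= 1) ->
    is_argmin classical_sets.setT (lasso_objective X0 lambda y) (s + t *: e).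
  move=> te; apply: (lasso_argmin g1).
    by rewrite mulmxDr -scalemxAr Xe scaler0 addr0 addrK.
  apply: eq_bigr => j _; rewrite -/g.
  rewrite [(s + _) _ _]mxE [s _ _]mxE [(t *: e) _ _]mxE.
  have [gj|gj] := eqVneq `|g j 0| 1; last first.
    rewrite mxE aL ?aR ?subrr ?mulr0 ?addr0 ?normr0 ?mulr0 //.
      by apply: contra_neq gj => ->; rewrite normrN normr1.
    by apply: contra_neq gj => ->; rewrite normr1.
  have gg : g j 0 * g j 0 = 1 by rewrite -expr2 -real_normK ?num_real // gj expr1n.
  have := te j; rewrite ler_norml => /andP[le1 le2].
  move: (g1 j); rewrite ler_norml => /andP[gl gr].
  have ge0 : 0 <= g j 0 * (g j 0 + t * e j 0) by rewrite mulrDr gg; nra.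
  by rewrite -(ger0_norm ge0) normrM gj mul1r.
pose t := (1 + \sum_j `|e j 0|)^-1.
have d0 : 0 < 1 + \sum_j `|e j 0| by rewrite ltr_pwDl // sumr_ge0.
have [x [_ xu]] := uniq y.
have m0 : is_argmin classical_sets.setT (lasso_objective X0 lambda y) (s + 0 *: e).
  by apply: argmin => j; rewrite mul0r normr0 ler01.
have mt : is_argmin classical_sets.setT (lasso_objective X0 lambda y) (s + t *: e).
  apply: argmin => j; rewrite normrM gtr0_norm ?invr_gt0 // mulrC ler_pdivrMr // mul1r.
  by rewrite (bigD1 j) //= addrCA lerDl addr_ge0 // sumr_ge0.
have e0 : e = 0.
  have := xu _ mt; rewrite (xu _ m0) scale0r addr0 => /esym/eqP.
  rewrite -subr_eq0 addrAC subrr add0r scaler_eq0 invr_eq0 gt_eqF //=.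
  by move/eqP.
apply/rowP => i; rewrite [RHS]mxE.
have ej j : a 0 (lshift p j) = a 0 (rshift p j).
  by apply/eqP; rewrite -subr_eq0; have := congr1 (fun w : 'cV_p => w j 0) e0; rewrite !mxE => ->.
case: (splitP i) => j ij.
  have -> : i = lshift p j by apply: val_inj.
  have [gj|/aL //] := eqVneq (g j 0) 1.
  by rewrite ej aR // gj eq_sym eqNr oner_eq0.
have -> : i = rshift p j by apply: val_inj.
have [gj|/aR //] := eqVneq (g j 0) (-1).
by rewrite -ej aL // gj eqNr oner_eq0.
Qed.

Lemma accessible_face S : accessible X0 lambda S -> face_set lasso_points S.
Proof.
case=> y [b /signed_kkt[le eq] <-].
set D := signed_design X0 in le eq; set z := y - D *m b in le eq.
have E : lasso_points *m (lambda^-1 *: ((col_base X0)^T *m z)) = lambda^-1 *: (D^T *m z).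
  by rewrite -scalemxAr lasso_points_lift.
apply/asboolP; exists (lambda^-1 *: ((col_base X0)^T *m z)).
  by apply/forallP => j; rewrite E mxE mulrC ler_pdivrMr // mul1r.
apply/subsetP => j; rewrite !inE => bj.
by rewrite E mxE eq // mulVf ?lt0r_neq0.
Qed.

Lemma num_accessible_le k : (num_accessible X0 lambda k <= nfaces lasso_points k)%N.
Proof.
apply/subset_leq_card/subsetP => S; rewrite !inE => /andP[/asboolP aS ->].
by rewrite (accessible_face aS).
Qed.

End LassoPolytope.

(** * Polytopes on the moment curve *)

Section Points.
Variables (R : realType) (v d : nat) (x : 'I_v -> 'cV[R]_d).
Implicit Types (S : {set 'I_v}) (a : 'I_v -> R).

Definition exposed S := exists (c : 'rV[R]_d) (c0 : R),
  forall i, (c *m x i) 0 0 <= c0 ?= iff (i \in S).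

Definition aff_free S := forall a, (forall i, i \notin S -> a i = 0) ->
  \sum_i a i = 0 -> \sum_i a i *: x i = 0 -> forall i, a i = 0.

Definition centroid : 'cV[R]_d := v%:R^-1 *: \sum_i x i.

Definition centered : 'M[R]_(v, d) := \matrix_(i, j) (x i - centroid) j 0.

Lemma centeredE (u : 'cV[R]_d) i :
  (centered *m u) i 0 = (u^T *m x i) 0 0 - (u^T *m centroid) 0 0.
Proof. by rewrite !mxE -sumrB; apply: eq_bigr => j _; rewrite !mxE; ring. Qed.

Lemma sum_centered j : \sum_i centered i j = 0.
Proof.
under eq_bigr do rewrite !mxE.
rewrite sumrB sumr_const card_ord summxE -[_ *+ v]mulr_natl.
case: (v) x => [|v'] x'; first by rewrite big_ord0 mul0r subrr.
by rewrite mulVKf ?subrr // pnatr_eq0.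
Qed.

Lemma face_exposed S : simplicial centered -> face_set centered S -> exposed S.
Proof.
move=> sX /(face_exact sX)[u /forallP fu tu].
exists u^T, (1 + (u^T *m centroid) 0 0) => i.
have := fu i; rewrite -tu inE centeredE lerBlDr subr_eq => le.
by split.
Qed.

(** A point off the hyperplane puts the centroid strictly below it, so the recentered functional can
    be scaled to the value 1 on [S]. *)
Lemma exposed_face S i : i \notin S -> exposed S -> face_set centered S.
Proof.
move=> NiS [c [c0 cS]].
have v0 : 0 < v%:R :> R by rewrite ltr0n; case: (v) i {NiS} => [[]|].
have co : (c *m centroid) 0 0 < c0.
  rewrite /centroid -scalemxAr mxE mulmx_sumr summxE mulrC ltr_pdivrMr //.
  rewrite mulr_natr -[X in _ *+ X]card_ord -sumr_const.
  rewrite (bigD1 i) //= [ltRHS](bigD1 i) //= ltr_leD //.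
    by rewrite (lt_leif (cS i)) NiS.
  by apply: ler_sum => j _; apply: (leif_le (cS j)).
pose g := c0 - (c *m centroid) 0 0.
have g0 : 0 < g by rewrite subr_gt0.
have E j : (centered *m (g^-1 *: c^T)) j 0 = ((c *m x j) 0 0 - (c *m centroid) 0 0) / g.
  by rewrite -scalemxAr mxE centeredE trmxK mulrC.
apply/asboolP; exists (g^-1 *: c^T).
  apply/forallP => j; rewrite E ler_pdivrMr // mul1r lerD2r.
  exact: (leif_le (cS j)).
apply/subsetP => j jS; rewrite inE E.
have /eqP -> : (c *m x j) 0 0 == c0 by rewrite (eq_leif (cS j)).
by rewrite divff ?lt0r_neq0.
Qed.

End Points.

Section MomentCurve.
Variables (R : realType) (v d : nat) (t : 'I_v -> R).
Hypothesis t_inj : injective t.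
Implicit Types (S : {set 'I_v}) (q : {poly R}).

Let x i := moment_point d (t i).

(** Affine functionals on the moment curve correspond to polynomials of degree at most d;
    [moment_poly] is the other direction. *)
Lemma horner_moment q s : (size q <= d.+1)%N ->
  q.[s] = q`_0 + ((\row_j q`_j.+1) *m moment_point d s) 0 0.
Proof.
move=> sq; rewrite (horner_coef_wide _ sq) big_ord_recl expr0 mulr1 mxE.
by congr (_ + _); apply: eq_bigr => j _; rewrite !mxE.
Qed.

Lemma moment_poly (u : 'cV[R]_d) (b : R) : exists q,
  [/\ (size q <= d.+1)%N, (q = 0 -> u = 0)
    & forall s, q.[s] = b + (u^T *m moment_point d s) 0 0].
Proof.
exists (b%:P + \sum_(j < d) u j 0 *: 'X^(j.+1)); split.
- rewrite (leq_trans (size_polyD _ _)) // geq_max (leq_trans (size_polyC_leq1 _)) //=.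
  apply: leq_trans (size_sum _ _ _) _; apply/bigmax_leqP => j _.
  by rewrite (leq_trans (size_scale_leq _ _)) // size_polyXn ltnS.
- move=> q0; apply/colP => i; rewrite mxE.
  have := congr1 (fun r : {poly R} => r`_i.+1) q0.
  rewrite coefD coefC /= add0r coef_sum coef0 (bigD1 i) //= coefZ coefXn eqxx mulr1.
  rewrite big1 ?addr0 // => k ki.
  by rewrite coefZ coefXn eqSS (inj_eq val_inj) eq_sym (negPf ki) mulr0.
move=> s; rewrite hornerD hornerC horner_sum mxE; congr (_ + _).
by apply: eq_bigr => j _; rewrite hornerZ hornerXn !mxE.
Qed.

Lemma card_roots S q : q != 0 -> (forall i, i \in S -> q.[t i] = 0) -> (#|S| < size q)%N.
Proof.
move=> q0 rS; rewrite cardE -(size_map t); apply: max_poly_roots => //.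
  by apply/allP => _ /mapP[i iS ->]; apply/eqP/rS; rewrite -mem_enum.
by rewrite map_inj_uniq // enum_uniq.
Qed.

Definition node_poly S : {poly R} := \prod_(j in S) ('X - (t j)%:P).

Lemma size_node_poly S : size (node_poly S) = #|S|.+1.
Proof. by rewrite /node_poly -big_enum size_prod_XsubC cardE. Qed.

Lemma node_poly_eq0 S i : ((node_poly S).[t i] == 0) = (i \in S).
Proof.
rewrite horner_prod; apply/prodf_eq0/idP => [[j jS]|iS].
  by rewrite hornerXsubC subr_eq0 => /eqP/t_inj ->.
by exists i; rewrite // hornerXsubC subrr.
Qed.

Lemma exposed_poly S q : (size q <= d.+1)%N -> (forall i, 0 <= q.[t i]) ->
  (forall i, (q.[t i] == 0) = (i \in S)) -> exposed x S.
Proof.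
move=> sq q0 qS; exists (- \row_j q`_j.+1), q`_0 => i.
have -> : ((- \row_j q`_j.+1) *m x i) 0 0 = q`_0 - q.[t i].
  by rewrite (horner_moment _ sq) opprD addrA subrr add0r mulNmx mxE.
split; first by rewrite gerBl.
by rewrite -subr_eq0 addrAC subrr add0r oppr_eq0.
Qed.

Lemma exposed_neighborly S : (#|S|.*2 <= d)%N -> exposed x S.
Proof.
move=> Sd; apply: (@exposed_poly S (node_poly S ^+ 2)).
- by rewrite (leq_trans (size_poly_exp_leq _ _)) // size_node_poly /= muln2.
- by move=> i; rewrite horner_exp sqr_ge0.
- by move=> i; rewrite horner_exp expf_eq0 /= node_poly_eq0.
Qed.

(** Lagrange interpolation in degree v - 1 <= d gives a polynomial equal to 0 on [S] and 1
    elsewhere. *)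
Lemma exposed_simplex S : (v <= d.+1)%N -> exposed x S.
Proof.
move=> vd.
pose L i := ((node_poly [set~ i]).[t i])^-1 *: node_poly [set~ i].
have LE i k : (L i).[t k] = (i == k)%:R.
  rewrite hornerZ; have [<-|ik] := eqVneq i k.
    by rewrite mulVf // node_poly_eq0 !inE eqxx.
  have /eqP -> : (node_poly [set~ i]).[t k] == 0 by rewrite node_poly_eq0 !inE eq_sym.
  by rewrite mulr0.
have qE k : (\sum_(i in ~: S) L i).[t k] = (k \notin S)%:R.
  rewrite horner_sum; under eq_bigr do rewrite LE.
  have [kS|kS] := boolP (k \in S).
    rewrite big1 // => i; rewrite inE => iS.
    by have [ik|//] := eqVneq i k; rewrite ik kS in iS.
  by rewrite (bigD1 k) ?inE //= eqxx big1 ?addr0 // => i /andP[_ /negPf ->].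
apply: (@exposed_poly S (\sum_(i in ~: S) L i)).
- apply: leq_trans (size_sum _ _ _) _; apply/bigmax_leqP => i _.
  rewrite (leq_trans (size_scale_leq _ _)) // size_node_poly cardsC1 card_ord.
  by have := ltn_ord i; lia.
- by move=> i; rewrite qE ler0n.
- by move=> i; rewrite qE pnatr_eq0 eqb0 negbK.
Qed.

(** Testing the dependence against [node_poly (S :\ i)], which vanishes at every point of [S] except
    [i], isolates [a i]. *)
Lemma moment_aff_free S : (#|S| <= d.+1)%N -> aff_free x S.
Proof.
move=> Sd a aS a1 ax i; have [iS|/aS //] := boolP (i \in S).
have sq : (size (node_poly (S :\ i)) <= d.+1)%N.
  by move: Sd; rewrite size_node_poly (cardsD1 i S) iS.
have : \sum_k a k * (node_poly (S :\ i)).[t k] = 0.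
  under eq_bigr do rewrite (horner_moment _ sq) mulrDr.
  rewrite big_split /= -mulr_suml a1 mul0r add0r.
  set c := \row_j _.
  transitivity ((c *m \sum_k a k *: x k) 0 0); last by rewrite ax mulmx0 mxE.
  by rewrite mulmx_sumr summxE; apply: eq_bigr => k _; rewrite -scalemxAr [RHS]mxE.
rewrite (bigD1 i) //= big1 => [|k ki].
  rewrite addr0 => /eqP; rewrite mulf_eq0 node_poly_eq0 !inE eqxx orbF.
  by move/eqP.
have [kS|/aS ->] := boolP (k \in S); last by rewrite mul0r.
have /eqP -> : (node_poly (S :\ i)).[t k] == 0 by rewrite node_poly_eq0 !inE ki.
by rewrite mulr0.
Qed.

(** Root counting: a polynomial of degree at most d with v > d roots is zero, and tight points are
    roots of a nonzero such polynomial, hence affinely independent. *)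
Lemma moment_simplicial : (d < v)%N -> simplicial (centered x).
Proof.
move=> dv; have v0 : v%:R != 0 :> R by rewrite pnatr_eq0; lia.
split; first exact: sum_centered.
  move=> u Xu.
  have [q [sq q0 qE]] := moment_poly u (- (u^T *m centroid x) 0 0).
  apply: q0; apply/eqP; apply: contraT => q0.
  have := @card_roots [set: 'I_v] q q0; rewrite cardsT card_ord => H.
  suff /H : forall i, i \in [set: 'I_v] -> q.[t i] = 0 by lia.
  move=> i _; rewrite qE addrC -centeredE Xu mxE //.
move=> u fu a a_tight aX.
have [q [sq _ qE]] := moment_poly (- u) (1 + (u^T *m centroid x) 0 0).
have qE' i : q.[t i] = 1 - (centered x *m u) i 0.
  rewrite qE centeredE /x.
  have -> : ((- u)^T *m moment_point d (t i)) 0 0 = - (u^T *m moment_point d (t i)) 0 0.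
    by rewrite linearN /= mulNmx mxE.
  by ring.
(* If [q] were 0, all entries of [centered x *m u] would be 1, but they sum to 0. *)
have q0 : q != 0.
  apply: contra_neq v0 => q0.
  rewrite -[RHS](sum_mulmx_eq0 u (sum_centered x)) -[in LHS](card_ord v) -sumr_const.
  apply: eq_bigr => i _; have := qE' i; rewrite q0 horner0 => /esym/eqP.
  by rewrite subr_eq0 => /eqP.
have ct : (#|tight (centered x) u| <= d.+1)%N.
  apply: ltnW; apply: leq_trans sq; apply: card_roots => // i.
  by rewrite inE qE' => /eqP ->; rewrite subrr.
(* The constraint value is 1 at tight points, so this sum is a X u = 0 and the linear dependence
   becomes an affine one. *)
have a1 : \sum_i a 0 i = 0.
  transitivity ((a *m centered x *m u) 0 0); last by rewrite aX mul0mx mxE.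
  rewrite -mulmxA mxE; apply: eq_bigr => i _.
  have [|/a_tight ->] := boolP (i \in tight (centered x) u); last by rewrite mul0r.
  by rewrite inE => /eqP ->; rewrite mulr1.
apply/rowP => i; rewrite mxE; apply: (moment_aff_free ct (a := a 0)) => //.
apply/colP => j; rewrite summxE mxE.
transitivity (\sum_k a 0 k * centered x k j); last first.
  by have := congr1 (fun w : 'rV_d => w 0 j) aX; rewrite /= mxE [RHS]mxE.
under [RHS]eq_bigr do rewrite mxE [(_ - _ : 'cV_d) _ _]mxE mulrDr.
rewrite big_split /= -mulr_suml a1 mul0r addr0.
by apply: eq_bigr => k _; rewrite mxE.
Qed.

End MomentCurve.

(** * Faces as point sets *)

From mathcomp Require Import finmap classical_sets cardinality.

Local Open Scope classical_set_scope.
Local Open Scope ring_scope.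

Section FaceCount.
Variables (R : realType) (v d : nat) (x : 'I_v -> 'cV[R]_d).
Implicit Types (S : {set 'I_v}) (a : 'I_v -> R).

Definition sub_hull S : set 'cV[R]_d := [set z | exists a,
  [/\ forall i, 0 <= a i, \sum_i a i = 1, z = \sum_i a i *: x i
    & forall i, i \notin S -> a i = 0]].

Lemma sub_hull_vertex S i : i \in S -> sub_hull S (x i).
Proof.
move=> iS; exists (fun j => (j == i)%:R); split=> [j|||j]; first exact: ler0n.
- by rewrite (bigD1 i) //= eqxx big1 ?addr0 // => j /negPf ->.
- rewrite (bigD1 i) //= eqxx scale1r big1 ?addr0 // => j /negPf ->.
  by rewrite scale0r.
- by have [->|//] := eqVneq j i; rewrite iS.
Qed.

Lemma sub_hull_sub S z : sub_hull S z -> conv_hull x z.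
Proof. by case=> a [a0 a1 az _]; exists a. Qed.

Lemma exposed_sub_hull S (c : 'rV[R]_d) c0 :
  (forall i, (c *m x i) 0 0 <= c0 ?= iff (i \in S)) ->
  (forall z, conv_hull x z -> (c *m z) 0 0 <= c0) /\
  sub_hull S = conv_hull x `&` [set z | (c *m z) 0 0 = c0].
Proof.
move=> cS.
have cE a : (c *m (\sum_i a i *: x i)) 0 0 = \sum_i a i * (c *m x i) 0 0.
  by rewrite mulmx_sumr summxE; apply: eq_bigr => i _; rewrite -scalemxAr mxE.
have le_c z : conv_hull x z -> (c *m z) 0 0 <= c0.
  case=> a [a0 a1 ->]; rewrite cE -[leRHS]mul1r -a1 mulr_suml.
  by apply: ler_sum => i _; rewrite ler_wpM2l // (leif_le (cS i)).
split=> //; apply/seteqP; split=> z.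
  move=> Sz; split; first exact: sub_hull_sub Sz.
  case: Sz => a [a0 a1 -> aS] /=; rewrite cE -[RHS]mul1r -a1 mulr_suml.
  apply: eq_bigr => i _; have [iS|/aS ->] := boolP (i \in S); last by rewrite !mul0r.
  by congr (_ * _); apply/eqP; rewrite (eq_leif (cS i)).
case=> -[a [a0 a1 ->]] /=; rewrite cE => ac; exists a; split=> // i iS.
have : \sum_i a i * (c0 - (c *m x i) 0 0) = 0.
  under eq_bigr do rewrite mulrBr.
  by rewrite sumrB -mulr_suml a1 mul1r ac subrr.
move/eqP; rewrite psumr_eq0 => [|j _]; last first.
  by rewrite mulr_ge0 // subr_ge0 (leif_le (cS j)).
move/allP => /(_ i); rewrite mem_index_enum => /(_ isT) /=.
by rewrite mulf_eq0 subr_eq0 [c0 == _]eq_sym (eq_leif (cS i)) (negPf iS) orbF => /eqP.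
Qed.

Lemma sub_hull_mem S i : exposed x S -> sub_hull S (x i) -> i \in S.
Proof.
case=> c [c0 cS]; have [_ ->] := exposed_sub_hull cS; case=> _ /= ci.
by rewrite -(eq_leif (cS i)) ci eqxx.
Qed.

Lemma exposed_is_face S : exposed x S -> is_face (conv_hull x) (sub_hull S).
Proof. by case=> c [c0 /exposed_sub_hull[le_c E]]; exists c, c0. Qed.

Section Direction.
Variables (S : {set 'I_v}) (i0 : 'I_v).
Hypothesis i0S : i0 \in S.

Definition edge_vectors :=
  [tuple x (@enum_val _ (mem (S :\ i0)%SET) i) - x i0 | i < #|(S :\ i0)%SET|].

Lemma edge_vectors_nth (i : 'I_#|(S :\ i0)%SET|) :
  edge_vectors`_i = x (enum_val i) - x i0.
Proof. by rewrite -tnth_nth tnth_mktuple. Qed.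

Lemma mem_edge_vectors j : j \in S -> x j - x i0 \in <<edge_vectors>>%VS.
Proof.
move=> jS; have [->|ji] := eqVneq j i0; first by rewrite subrr mem0v.
have jA : j \in (S :\ i0)%SET by rewrite !inE ji.
apply: memv_span; apply/tnthP; exists (enum_rank_in jA j).
by rewrite tnth_mktuple enum_rankK_in.
Qed.

Lemma edge_vectors_free : aff_free x S -> free edge_vectors.
Proof.
move=> fS; apply/freeP => k; under eq_bigr do rewrite edge_vectors_nth; move=> k0.
pose f : 'I_#|(S :\ i0)%SET| -> 'I_v := @enum_val _ (mem (S :\ i0)%SET).
have fA i : f i \in (S :\ i0)%SET by apply: enum_valP.
have fi0 i : f i != i0 by have := fA i; rewrite !inE => /andP[].
(* The dependence of the differences becomes one of the points: [i0] receives minus the total, so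
   the coefficients sum to 0. *)
pose a j := \sum_(i | f i == j) k i - (\sum_i k i) *+ (j == i0).
have sumE (V : lmodType R) (y : 'I_v -> V) :
    \sum_j a j *: y j = \sum_i k i *: (y (f i) - y i0).
  rewrite /a; under eq_bigr do rewrite scalerBl scaler_suml.
  rewrite sumrB; under [RHS]eq_bigr do rewrite scalerBr.
  rewrite sumrB -[in RHS]scaler_suml; congr (_ - _).
    rewrite (exchange_big_dep xpredT) //=; apply: eq_bigr => i _.
    by rewrite (big_pred1 (f i)) // => j; rewrite eq_sym.
  rewrite (bigD1 i0) //= eqxx [X in _ + X]big1 ?addr0 // => j /negPf ->.
  by rewrite mulr0n scale0r.
have a0 : forall j, a j = 0.
  apply: fS.
  - move=> j jS; rewrite /a big1 => [|i /eqP fj].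
      have [ji|_] := eqVneq j i0; first by rewrite ji i0S in jS.
      by rewrite subr0.
    by have := fA i; rewrite fj !inE (negPf jS) andbF.
  - have := sumE R^o (fun=> 1); rewrite [RHS]big1 => [E|i _]; last by rewrite subrr scaler0.
    by rewrite -[RHS]E; apply: eq_bigr => j _; rewrite /GRing.scale /= mulr1.
  - by rewrite sumE.
move=> i; have := a0 (f i); rewrite /a (negPf (fi0 i)) subr0 (big_pred1 i) //.
by move=> l /=; rewrite (inj_eq enum_val_inj).
Qed.

Lemma aff_hull_sub_hull :
  aff_hull (sub_hull S) = [set x i0 + u | u in [set u | u \in <<edge_vectors>>%VS]].
Proof.
apply/seteqP; split=> z.
  case=> m [y [b [yS b1 ->]]]; exists (\sum_l b l *: (y l - x i0)).
    apply: memv_suml => l _; apply: memvZ.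
    have [a [_ a1 -> aS]] := yS l.
    have -> : \sum_i a i *: x i - x i0 = \sum_i a i *: (x i - x i0).
      under [RHS]eq_bigr do rewrite scalerBr.
      by rewrite sumrB -scaler_suml a1 scale1r.
    apply: memv_suml => i _; have [iS|/aS ->] := boolP (i \in S).
      by apply: memvZ; apply: mem_edge_vectors.
    by rewrite scale0r mem0v.
  under eq_bigr do rewrite scalerBr.
  by rewrite sumrB -scaler_suml b1 scale1r addrC subrK.
case=> u /= uU <-.
pose k i := coord edge_vectors i u.
have uE : u = \sum_(i < #|(S :\ i0)%SET|) k i *: (x (enum_val i) - x i0).
  by rewrite {1}(coord_span (X := edge_vectors) uU); apply: eq_bigr => i _;
     rewrite edge_vectors_nth.
(* Index [ord0] carries the base point [x i0], with the coefficient that makes the sum 1. *)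
pose y j := oapp (fun i : 'I_#|(S :\ i0)%SET| => x (enum_val i)) (x i0) (unlift ord0 j).
pose b j := oapp k (1 - \sum_i k i) (unlift ord0 j).
exists _, y, b; split.
- move=> j; rewrite /y; case: unliftP => [i _|_] /=; apply: sub_hull_vertex => //.
  by have := enum_valP i; rewrite !inE => /andP[].
- rewrite big_ord_recl /b unlift_none /=.
  by under [X in _ + X]eq_bigr do rewrite liftK /=; rewrite subrK.
rewrite big_ord_recl /b /y unlift_none /=; under [X in _ = _ + X]eq_bigr do rewrite liftK /=.
rewrite uE scalerBl scale1r -addrA; congr (_ + _).
rewrite scaler_suml addrC -sumrB; apply: eq_bigr => i _.
by rewrite scalerBr.
Qed.

End Direction.

Lemma has_dim_sub_hull S : aff_free x S -> has_dim (sub_hull S) (#|S|%:Z - 1).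
Proof.
move=> fS; have [->|[i0 i0S]] := set_0Vmem S.
  left; rewrite cards0; split=> //; apply/seteqP; split=> // z [a [_ a1 _ aS]].
  move: a1; rewrite big1 => [/eqP|i _]; first by rewrite eq_sym oner_eq0.
  by apply: aS; rewrite inE.
right; exists (x i0), <<edge_vectors S i0>>%VS; split; first exact: aff_hull_sub_hull.
have := edge_vectors_free i0S fS; rewrite /free size_tuple => /eqP ->.
by rewrite (cardsD1 i0 S) i0S PoszD addrAC subrr add0r.
Qed.

(** Exposed sets inject into faces, being recovered as the indices of the points in their hulls;
    affine independence gives the dimension. *)
Lemma num_faces_ge k : (forall S, #|S| = k -> aff_free x S) ->
  (#|[set S : {set 'I_v} | `[< exposed x S >] & #|S| == k]%SET|
     <= num_faces (conv_hull x) (k%:Z - 1))%N.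
Proof.
move=> fk; set G := finset _.
have inj : {in G &, injective sub_hull}.
  move=> S S'; rewrite !inE => /andP[/asboolP eS _] /andP[/asboolP eS' _] E.
  apply/setP => i; apply/idP/idP => /sub_hull_vertex.
    by rewrite E; apply: sub_hull_mem.
  by rewrite -E; apply: sub_hull_mem.
rewrite /num_faces cardE -(size_map sub_hull).
have -> : size (map sub_hull (enum G)) = #|` [fset F in map sub_hull (enum G)]|%fset.
  rewrite card_fseq undup_id // map_inj_in_uniq ?enum_uniq // => S S'.
  by rewrite !mem_enum; apply: inj.
apply: fsubset_leq_card; apply/fsubsetP => F; rewrite inE => /mapP[S].
rewrite mem_enum inE => /andP[/asboolP eS /eqP Sk] ->.
rewrite in_fset_set; last exact: finite_faces.
rewrite inE; split; first exact: exposed_is_face.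
by rewrite -Sk; apply/has_dim_sub_hull/fk.
Qed.

End FaceCount.

Theorem theorem3p2 (R : realType) (n p : nat) (X0 : 'M[R]_(n, p)) (lambda : R)
    (lambda_gt0 : 0 < lambda) (X0_unique : lasso_unique X0 lambda)
    (t : 'I_(2 * p) -> R) (t_inj : injective t) (k : nat) :
  (num_accessible X0 lambda k <= num_faces (cyclic_polytope n t) (k%:Z - 1))%N.
Proof.
apply: leq_trans (num_accessible_le X0 lambda_gt0 k) _.
have sX := lasso_points_simplicial lambda_gt0 X0_unique.
set r := \rank X0 in sX *.
have [kr|rk] := leqP k r; last by rewrite nfaces_gt.
have rn : (r <= n)%N by apply: rank_leq_row.
have rp : (r <= p)%N by apply: rank_leq_col.
have aff (S : {set 'I_(2 * p)}) : #|S| = k -> aff_free (fun i => moment_point n (t i)) S.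
  by move=> Sk; apply: moment_aff_free => //; rewrite Sk; lia.
apply: leq_trans (num_faces_ge aff).
(* With at most n + 1 points the cyclic polytope is a simplex, and all C(2p, k) subsets of size k
   are exposed. *)
have [simplex|big] := leqP (2 * p) n.+1.
  have all_exposed (S : {set 'I_(2 * p)}) : exposed (fun i => moment_point n (t i)) S.
    exact: exposed_simplex.
  apply: (@leq_trans 'C(2 * p, k)).
    rewrite mul2n -addnn -[in X in (_ <= X)%N](card_ord (p + p)) -card_draws.
    by apply/subset_leq_card/fintype.subsetP => S; rewrite !inE => /andP[].
  rewrite -[X in 'C(X, _)]card_ord -card_draws.
  apply/subset_leq_card/fintype.subsetP => S; rewrite !inE => ->; rewrite andbT.
  exact/asboolP.
have sC := moment_simplicial t_inj (ltnW big).
have [a va] : exists a, (2 * p)%N = (a + n).+1 by exists (2 * p - n.+1)%N; lia.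
have nr : n = (r + (n - r))%N by rewrite subnKC.
apply: (@leq_trans (nfaces (centered (fun i => moment_point n (t i))) k)); last first.
  apply/subset_leq_card/fintype.subsetP => S; rewrite !inE => /andP[fS ->]; rewrite andbT.
  by apply/asboolP/face_exposed.
rewrite (nfaces_neighborly sC va); first last.
- exact: leq_trans kr rn.
- move=> j jn; rewrite /nfaces -[in RHS](card_ord (2 * p)) -card_draws; congr #|pred_of_set _|.
  apply/setP => S; rewrite !inE; case: eqP => // Sj; rewrite ?andbF // andbT.
  have [i iS] : exists i, i \notin S.
    apply/existsP; rewrite -negb_forall; apply/negP => /forallP allS.
    have : (#|S| < 2 * p)%N by lia.
    rewrite -[X in (_ < X)%N]card_ord -cardsT; apply/negP; rewrite -leqNgt.
    by apply/subset_leq_card/fintype.subsetP => l _; apply: allS.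
  by apply: (exposed_face iS); apply: exposed_neighborly => //; rewrite Sj.
(* In dimension r, 2p points have excess a + (n - r); [nbr_sum_mono] then passes to dimension n. *)
have vr : (p + p = ((a + (n - r)) + r).+1)%N by lia.
apply: leq_trans (nfaces_le sX vr kr) _.
rewrite [X in (_ <= X)%N](eq_bigr
  (fun i : 'I_k.+1 => nbr_h a (r + (n - r)) i * 'C(r + (n - r) - i, k - i)))%N.
  exact: nbr_sum_mono.
by rewrite subnKC.
Qed.
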